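(* Let $a<b$ be real numbers, $q\ge 1$, $n\ge 0$ integers, and let $(s_k)_{k=0}^{2n+1}$ be a sequence of Hermitian $q\times q$ matrices which is Hausdorff positive definite on $[a,b]$, i.e. the block Hankel matrices $H_{3,n}$ and $H_{4,n}$ are positive definite. Assume that $\widetilde H_{1,n}$ and (if $n\ge1$) $\widetilde H_{1,n-1}$ are invertible. Let $U^{(2n+1)}$, $V^{(2n+1)}$ be the $2q\times 2q$ resolvent matrices, and $\mathfrak J_q$, $\mathfrak D^{(2n+1)}$ the $2q\times 2q$ matrices, defined in the context. Then for all $z\in\mathbb C\setminus\{a\}$ $$U^{(2n+1)}(z)=\mathfrak J_q\,V^{(2n+1)}(z)\,\mathfrak J_q\,\mathfrak D^{(2n+1)} .$$
   Context: All block entries are $q\times q$ complex matrices; $I$ and $0$ are identity and zero matrices of appropriate size. For a matrix function $F$ write $F^*(z):=(F(z))^*$ and $F^{*-1}(z):=((F(z))^* )^{-1}$. Moments: $s^{(1)}_j=s_j$, $s^{(2)}_j=-ab\,s_j+(a+b)s_{j+1}-s_{j+2}$, $s^{(3)}_j=b s_j-s_{j+1}$, $s^{(4)}_j=-a s_j+s_{j+1}$. For $r=1,2,3,4$: $H_{r,j}=(s^{(r)}_{k+\ell})_{k,\ell=0}^{j}$, $\widetilde H_{1,j}=(s_{k+\ell+1})_{k,\ell=0}^{j}$, and for $j\ge1$, $Y_{r,j}$ is the block column with entries $s^{(r)}_j,\dots,s^{(r)}_{2j-1}$. $T_j$ is the $(j+1)\times(j+1)$ block matrix with $I$ on the first block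 subdiagonal and $0$ elsewhere ($T_0=0$); $R_j(z)=(I-zT_j)^{-1}$; $v_j$ is the block column $(I,0,\dots,0)^{T}$ with $j+1$ blocks ($v_0=I$); $u_j$ is the block column with entries $-s_0,\dots,-s_j$. $u_{1,j}=T_ju_j$; $u_{3,j}=-(I-bT_j)u_j$; $u_{4,j}=(I-aT_j)u_j$; $\widehat u_{2,j}$ is the block column with entries $s_1-(a+b)s_0,\,-s^{(2)}_0,\dots,-s^{(2)}_{j-1}$ ($j+1$ blocks); $u_{2,j}=u_{2,j}(z)=\widehat u_{2,j}+z v_j s_0$ for $j\ge 1$. $\Sigma_{r,j}$ is the block column consisting of $-H_{r,j-1}^{-1}Y_{r,j}$ followed by $I$ ($j\ge1$), and $\Sigma_{r,0}=I$. Matrix polynomials: $P_{r,0}(z)=I$, $P_{r,j}(z)=\Sigma_{r,j}^*R_j(z)v_j$; $Q_{1,0}=0$, $Q_{1,j}(z)=-\Sigma_{1,j}^*R_j(z)u_{1,j}$; $Q_{2,0}(z)=(a+b)s_0-s_1-z s_0$, $Q_{2,j}(z)=-\Sigma_{2,j}^*R_j(z)u_{2,j}(z)$ ($j\ge1$). Under the hypotheses the matrices $P_{1,n+1}(a)$, $Q_{2,n}(a)$ and $P_{1,n+1}(0)$ are invertible, and $H_{2,n-1}$, $H_{1,n}$ are positive definite. Resolvent matrix in the point $a$: $U^{(2n+1)}(z)=\begin{pmatrix} \alpha(z) & \beta(z) \\ \gamma(z) & \delta(z) \end{pmatrix}$ with $\alpha(z)=Q_{2,n}^*(\bar z)Q_{2,n}^{*-1}(a)$,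 $\beta(z)=-Q_{1,n+1}^*(\bar z)P_{1,n+1}^{*-1}(a)$, $\gamma(z)=-(b-z)(z-a)P_{2,n}^*(\bar z)Q_{2,n}^{*-1}(a)$, $\delta(z)=P_{1,n+1}^*(\bar z)P_{1,n+1}^{*-1}(a)$. Resolvent matrix in the point $0$: put $$\widetilde V_4^{(n)}(z)=\begin{pmatrix} I+z v_n^*R_n^*(\bar z)H_{4,n}^{-1}u_{4,n} & -z v_n^*R_n^*(\bar z)H_{4,n}^{-1}v_n \\ z u_{4,n}^*R_n^*(\bar z)H_{4,n}^{-1}u_{4,n} & I-z u_{4,n}^*R_n^*(\bar z)H_{4,n}^{-1}v_n \end{pmatrix},$$ $M^{(2n+1)}=-a\,u_n^*\widetilde H_{1,n}^{-1}u_n$, $N^{(2n+1)}=-b\,v_n^*H_{4,n}^{-1}\widetilde H_{1,n}H_{3,n}^{-1}v_n$, $$V_4^{(2n+1)}(z)=\widetilde V_4^{(n)}(z)\begin{pmatrix} I & 0 \\ M^{(2n+1)} & I \end{pmatrix}\begin{pmatrix} I & N^{(2n+1)} \\ 0 & I \end{pmatrix},$$ $$V^{(2n+1)}(z)=\begin{pmatrix} I & 0 \\ 0 & (z-a)^{-1}I \end{pmatrix}V_4^{(2n+1)}(z)\begin{pmatrix} I & 0 \\ 0 & (z-a)I \end{pmatrix},\quad z\ne a.$$ Finally $\mathfrak J_q=\begin{pmatrix} 0 & I \\ I & 0 \end{pmatrix}$, $d^{(2n+1)}=P_{1,n+1}^*(0)P_{1,n+1}^{*-1}(a)$, and $\mathfrak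 D^{(2n+1)}=\begin{pmatrix} ((d^{(2n+1)})^* )^{-1} & 0 \\ 0 & d^{(2n+1)} \end{pmatrix}$. *)

(* Defs.v *)
From HB Require Import structures.
From mathcomp Require Import all_boot all_order all_algebra.
From mathcomp Require Export complex reals.

Set Implicit Arguments.
Unset Strict Implicit.
Unset Printing Implicit Defensive.

Import Order.TTheory GRing.Theory Num.Theory.
Local Open Scope ring_scope.
Local Open Scope sesquilinear_scope.

Definition posdefmx (C : numClosedFieldType) (m : nat) (A : 'M[C]_m) : Prop :=
  A \is hermsymmx /\
  forall x : 'cV[C]_m, x != 0 -> 0 < (x ^t* *m A *m x) ord0 ord0.

(* A finite moment sequence s_0, ..., s_(2n+1) is the restriction of a function *)
(* s : nat -> 'M_q; the values of s beyond 2n+1 are never used.  The end points *)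
(* a and b are taken in C; they are images of real numbers in the applications. *)
(* Matrices made of q x q blocks are indexed by \sum_(i < j.+1) q, following    *)
(* \mxblock and \mxcol.                                                         *)
Section ResolventMatrices.
Variables (C : numClosedFieldType) (q : nat).
Implicit Types (a b z : C) (s t : nat -> 'M[C]_q) (j n : nat).

Definition moment2 a b s j : 'M[C]_q :=
  - (a * b) *: s j + (a + b) *: s j.+1 - s j.+2.
Definition moment3 b s j : 'M[C]_q := b *: s j - s j.+1.
Definition moment4 a s j : 'M[C]_q := - a *: s j + s j.+1.

Definition blockHankel t j : 'M[C]_(\sum_(k < j.+1) q) :=
  \mxblock_(k < j.+1, l < j.+1) (t (k + l)%N : 'M[C]_q).

Definition H3 b s := blockHankel (moment3 b s).
Definition H4 a s := blockHankel (moment4 a s).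
Definition Htilde1 s := blockHankel (fun j => s j.+1).

(* Y t j has the j blocks t_j, ..., t_(2j-1). *)
Definition Y t j : 'M[C]_(\sum_(k < j) q, q) :=
  \mxcol_(k < j) (t (j + k)%N : 'M[C]_q).

Definition T j : 'M[C]_(\sum_(k < j.+1) q) :=
  \mxblock_(k < j.+1, l < j.+1)
    (if nat_of_ord k == l.+1 then 1%:M else 0 : 'M[C]_q).

Definition Res j z : 'M[C]_(\sum_(k < j.+1) q) := invmx (1%:M - z *: T j).

Definition vcol j : 'M[C]_(\sum_(k < j.+1) q, q) :=
  \mxcol_(k < j.+1) (if nat_of_ord k == 0%N then 1%:M else 0 : 'M[C]_q).

Definition ucol s j : 'M[C]_(\sum_(k < j.+1) q, q) :=
  \mxcol_(k < j.+1) (- s k : 'M[C]_q).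

Definition u1 s j := T j *m ucol s j.
Definition u4 a s j := (1%:M - a *: T j) *m ucol s j.

Definition uhat2 a b s j : 'M[C]_(\sum_(k < j.+1) q, q) :=
  \mxcol_(k < j.+1)
    (if nat_of_ord k is k'.+1 then - moment2 a b s k'
     else s 1%N - (a + b) *: s 0%N : 'M[C]_q).

Definition u2 a b s j z := uhat2 a b s j + z *: (vcol j *m s 0%N).

(* For j > 0 the first j blocks are those of - H_(j-1)^-1 Y_j, and the last     *)
(* block, the one with unlift ord_max k = None, is the identity.                *)
Definition Sigma t j : 'M[C]_(\sum_(k < j.+1) q, q) :=
  match j with
  | 0 => \mxcol_(k < 1) (1%:M : 'M[C]_q)
  | j'.+1 =>
    \mxcol_(k < j'.+2)
      (if unlift ord_max k is Some i
       then submxcol (- (invmx (blockHankel t j') *m Y t j'.+1)) i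
       else 1%:M : 'M[C]_q)
  end.

Definition P t j z : 'M[C]_q :=
  if j is 0 then 1%:M else (Sigma t j) ^t* *m Res j z *m vcol j.

Definition P1 s := P s.
Definition P2 a b s := P (moment2 a b s).

Definition Q1 s j z : 'M[C]_q :=
  if j is 0 then 0 else - ((Sigma s j) ^t* *m Res j z *m u1 s j).

Definition Q2 a b s j z : 'M[C]_q :=
  if j is 0 then (a + b) *: s 0%N - s 1%N - z *: s 0%N
  else - ((Sigma (moment2 a b s) j) ^t* *m Res j z *m u2 a b s j z).

(* U is the resolvent matrix in the point a, V below the one in the point 0. *)
Definition U a b s n z : 'M[C]_(q + q) :=
  let Q2a' := invmx ((Q2 a b s n a) ^t*) in
  let P1a' := invmx ((P1 s n.+1 a) ^t*) in
  block_mx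
    ((Q2 a b s n z^*) ^t* *m Q2a')
    (- ((Q1 s n.+1 z^*) ^t* *m P1a'))
    (- ((b - z) * (z - a)) *: ((P2 a b s n z^*) ^t* *m Q2a'))
    ((P1 s n.+1 z^*) ^t* *m P1a').

Definition Vtilde4 a s n z : 'M[C]_(q + q) :=
  let v := vcol n in
  let u := u4 a s n in
  let RH := (Res n z^*) ^t* *m invmx (H4 a s n) in
  block_mx
    (1%:M + z *: (v ^t* *m RH *m u))
    (- (z *: (v ^t* *m RH *m v)))
    (z *: (u ^t* *m RH *m u))
    (1%:M - z *: (u ^t* *m RH *m v)).

Definition Mmx a s n : 'M[C]_q :=
  - a *: ((ucol s n) ^t* *m invmx (Htilde1 s n) *m ucol s n).

Definition Nmx a b s n : 'M[C]_q :=
  - b *: ((vcol n) ^t* *m invmx (H4 a s n) *m Htilde1 s n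
            *m invmx (H3 b s n) *m vcol n).

Definition V4 a b s n z : 'M[C]_(q + q) :=
  Vtilde4 a s n z *m block_mx 1%:M 0 (Mmx a s n) 1%:M
    *m block_mx 1%:M (Nmx a b s n) 0 1%:M.

(* Meaningful for z != a only. *)
Definition V a b s n z : 'M[C]_(q + q) :=
  block_mx 1%:M 0 0 ((z - a)^-1)%:M *m V4 a b s n z
    *m block_mx 1%:M 0 0 (z - a)%:M.

Definition Jmx : 'M[C]_(q + q) := block_mx 0 1%:M 1%:M 0.

Definition dmx a s n : 'M[C]_q :=
  (P1 s n.+1 0) ^t* *m invmx ((P1 s n.+1 a) ^t*).

Definition Dmx a s n : 'M[C]_(q + q) :=
  block_mx (invmx ((dmx a s n) ^t*)) 0 0 (dmx a s n).

End ResolventMatrices.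

Arguments Jmx {C q}.

(* Main.v *)
(* Write v = v_n, u = u_n, T = T_n, K(z) = R_n^*(conj z), Ht for the shifted
   Hankel matrix and H1 for H_(1,n), so that H3 = b H1 - Ht, H4 = Ht - a H1.
   Everything rests on the displacement identity H1 = T Ht - v u^* and its
   adjoint.  They turn the four blocks of V_4 into
     I + z v^* K Ht^-1 u,           -(b - z) v^* K G v,
     (z - a) u^* K Ht^-1 u,          d^* + (z - a) u^* (I - b T^* ) K G v,
   with G = H3^-1 Ht H4^-1 and d = I - a v^* H4^-1 u, since
   H4 Ht^-1 u = u_4 - v M, and H3, H4 commute through Ht^-1.
   Dropping the first block c = P_(1,n+1)^*(0) of Sigma_(1,n+1) leaves a
   column w with Ht w = u c, so the first block column of V_4 consists of
   P_(1,n+1)^* c^-1 and -(z - a) Q_(1,n+1)^* c^-1; moreover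
   d = c P_(1,n+1)^*(a)^-1.  Similarly S = Sigma_(2,n) satisfies
   (I - a T) H3 S = v Q_(2,n)^*(a), because s^(2)_j = s^(3)_(j+1) - a s^(3)_j;
   hence G v E = S with d^* E = Q_(2,n)^*(a), which identifies the second
   block column. *)

Require Import Defs.
From mathcomp Require Import all_boot all_order all_algebra.
From mathcomp Require Import ring.

Set Implicit Arguments.
Unset Strict Implicit.
Unset Printing Implicit Defensive.

Import Order.TTheory GRing.Theory Num.Theory.
Local Open Scope ring_scope.
Local Open Scope sesquilinear_scope.

(** * Adjoints, and kernels of positive definite matrices *)

Lemma trmxCM (C : numClosedFieldType) m n p (A : 'M[C]_(m, n)) (B : 'M_(n, p)) :
  (A *m B) ^t* = B ^t* *m A ^t*.
Proof. by rewrite trmx_mul map_mxM. Qed.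

Lemma trmxCD (C : numClosedFieldType) m n (A B : 'M[C]_(m, n)) :
  (A + B) ^t* = A ^t* + B ^t*.
Proof. by rewrite linearD map_mxD. Qed.

Lemma trmxCN (C : numClosedFieldType) m n (A : 'M[C]_(m, n)) :
  (- A) ^t* = - A ^t*.
Proof. by rewrite linearN map_mxN. Qed.

Lemma trmxCZ (C : numClosedFieldType) m n (c : C) (A : 'M[C]_(m, n)) :
  (c *: A) ^t* = c^* *: A ^t*.
Proof. by rewrite linearZ map_mxZ. Qed.

Lemma trmxC1 (C : numClosedFieldType) n : (1%:M : 'M[C]_n) ^t* = 1%:M.
Proof. by rewrite trmx1 map_mx1. Qed.

Lemma trmxCV (C : numClosedFieldType) n (A : 'M[C]_n) :
  (invmx A) ^t* = invmx (A ^t*).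
Proof. by rewrite trmx_inv map_invmx. Qed.

Lemma unitmx_trmxC (C : numClosedFieldType) n (A : 'M[C]_n) :
  (A ^t* \in unitmx) = (A \in unitmx).
Proof. by rewrite map_unitmx unitmx_tr. Qed.

Definition trmxCE := (trmxCM, trmxCD, trmxCN, trmxCZ, trmxC1, trmxCV).

Lemma hermsymmx_trmxC (C : numClosedFieldType) n (A : 'M[C]_n) :
  A \is hermsymmx -> A ^t* = A.
Proof. by move/is_hermitianmxP; rewrite expr0 scale1r => {2}->. Qed.

Lemma unitmx_ker (F : fieldType) n (A : 'M[F]_n) :
  (forall x : 'cV_n, A *m x = 0 -> x = 0) -> A \in unitmx.
Proof.
move=> A_inj; rewrite -unitmx_tr -row_free_unit; apply: inj_row_free => v vA.
apply: trmx_inj; rewrite trmx0; apply: A_inj.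
by rewrite -[A]trmxK -trmx_mul vA trmx0.
Qed.

Lemma posdefmx_eq0 (C : numClosedFieldType) n (A : 'M[C]_n) (x : 'cV_n) :
  posdefmx A -> (x ^t* *m A *m x) ord0 ord0 <= 0 -> x = 0.
Proof.
case=> _ Apos x_le0; apply/eqP/negPn/negP => /Apos.
by rewrite le_gtF.
Qed.

Lemma posdefmx_ge0 (C : numClosedFieldType) n (A : 'M[C]_n) (x : 'cV_n) :
  posdefmx A -> 0 <= (x ^t* *m A *m x) ord0 ord0.
Proof.
case=> _ Apos; have [->|/Apos /ltW//] := eqVneq x 0.
by rewrite mulmx0 mxE.
Qed.

Lemma posdefmx_unit (C : numClosedFieldType) n (A : 'M[C]_n) :
  posdefmx A -> A \in unitmx.
Proof.
move=> Apos; apply: unitmx_ker => x Ax.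
by apply: posdefmx_eq0 Apos _; rewrite -mulmxA Ax mulmx0 mxE.
Qed.

(** * Calculus of block columns *)

(** Blocks come from a sequence over [nat], so that shifts are plain case distinctions; values
    beyond [n] are ignored. *)
Definition bcol (C : numClosedFieldType) q n m (x : nat -> 'M[C]_(q, m)) :
  'M[C]_(\sum_(k < n.+1) q, m) := \mxcol_(k < n.+1) x k.

Section BlockColumns.
Variables (C : numClosedFieldType) (q n : nat).
Implicit Types (a b z : C) (s t : nat -> 'M[C]_q).

Lemma eq_bcol m (x y : nat -> 'M[C]_(q, m)) :
  (forall k, (k <= n)%N -> x k = y k) -> bcol n x = bcol n y.
Proof. by move=> xy; apply: eq_mxcol => k; apply: xy; rewrite -ltnS. Qed.

Lemma bcol_inj m (x y : nat -> 'M[C]_(q, m)) :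
  bcol n x = bcol n y -> forall k, (k <= n)%N -> x k = y k.
Proof.
move=> xy k; rewrite -ltnS => kn.
by have := congr1 (fun X => submxcol X (Ordinal kn)) xy; rewrite !mxcolK.
Qed.

Lemma bcolP m (X : 'M[C]_(\sum_(k < n.+1) q, m)) :
  exists x : nat -> 'M[C]_(q, m), X = bcol n x.
Proof.
exists (fun k => submxcol X (inord k)).
by rewrite -{1}[X]submxcolK; apply: eq_mxcol => k; rewrite inord_val.
Qed.

Lemma bcol0 m : bcol n (fun=> 0 : 'M[C]_(q, m)) = 0.
Proof. exact: mxcol0. Qed.

Lemma bcolD m (x y : nat -> 'M[C]_(q, m)) :
  bcol n x + bcol n y = bcol n (fun k => x k + y k).
Proof. by rewrite /bcol mxcolD. Qed.

Lemma bcolN m (x : nat -> 'M[C]_(q, m)) : - bcol n x = bcol n (fun k => - x k).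
Proof. by rewrite /bcol mxcolN. Qed.

Lemma bcolZ m z (x : nat -> 'M[C]_(q, m)) :
  z *: bcol n x = bcol n (fun k => z *: x k).
Proof. by apply/matrixP => i j; rewrite !mxE. Qed.

Lemma bcol_mul m p (x : nat -> 'M[C]_(q, m)) (A : 'M[C]_(m, p)) :
  bcol n x *m A = bcol n (fun k => x k *m A).
Proof. exact: mxcol_mul. Qed.

Lemma mul_bcol m p (x : nat -> 'M[C]_(q, m)) (y : nat -> 'M[C]_(q, p)) :
  (bcol n x) ^t* *m bcol n y = \sum_(k < n.+1) (x k) ^t* *m y k.
Proof.
rewrite -mul_mxrow_mxcol; congr (_ *m _).
by apply/matrixP => i j; rewrite !mxE.
Qed.

Lemma blockHankel_bcol m t (x : nat -> 'M[C]_(q, m)) :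
  blockHankel t n *m bcol n x =
    bcol n (fun k => \sum_(l < n.+1) t (k + l)%N *m x l).
Proof. exact: mul_mxblock_mxrow. Qed.

Lemma T_bcol m (x : nat -> 'M[C]_(q, m)) :
  T C q n *m bcol n x = bcol n (fun k => if k is k'.+1 then x k' else 0).
Proof.
rewrite /T /bcol mul_mxblock_mxrow; apply: eq_mxcol => -[[|k] /= lek].
  by rewrite big1 // => l _; rewrite mul0mx.
have lek' : (k < n.+1)%N by apply: ltnW.
rewrite (bigD1 (Ordinal lek')) //= eqxx mul1mx big1 ?addr0 // => l lk.
case: eqP => [[kl]|]; last by rewrite mul0mx.
by case/eqP: lk; apply: val_inj.
Qed.

Lemma vcol_bcol :
  vcol C q n = bcol n (fun k => if k is 0 then 1%:M else 0 : 'M[C]_q).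
Proof. by apply: eq_mxcol => -[[|k] ?]. Qed.

Lemma uhat2_bcol a b s : uhat2 a b s n =
  bcol n (fun k => if k is k'.+1 then - moment2 a b s k'
                   else s 1%N - (a + b) *: s 0%N).
Proof. by []. Qed.

Lemma vcol_tr_mul_bcol m (x : nat -> 'M[C]_(q, m)) :
  (vcol C q n) ^t* *m bcol n x = x 0%N.
Proof.
rewrite vcol_bcol mul_bcol big_ord_recl big1 => [|k _].
  by rewrite /= trmxC1 mul1mx addr0.
by rewrite /= trmx0 map_mx0 mul0mx.
Qed.

Lemma mul_bcol_eq p (A B : 'M[C]_(p, \sum_(k < n.+1) q)) :
  (forall m (x : nat -> 'M[C]_(q, m)), A *m bcol n x = B *m bcol n x) -> A = B.
Proof.
move=> AB; rewrite -[A]mulmx1 -[B]mulmx1.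
by have [x ->] := bcolP 1%:M; exact: AB.
Qed.

End BlockColumns.

(** * Displacement and invertibility of block Hankel matrices *)

Section Moments.
Variables (C : numClosedFieldType) (q : nat).
Implicit Types (a b z : C) (s t : nat -> 'M[C]_q).

Lemma H3E b s n : H3 b s n = b *: blockHankel s n - Htilde1 s n.
Proof. by apply/matrixP => i j; rewrite !mxE. Qed.

Lemma H4E a s n : H4 a s n = Htilde1 s n - a *: blockHankel s n.
Proof. by apply/matrixP => i j; rewrite !mxE mulNr addrC. Qed.

Lemma moment2_moment3 a b s k :
  moment2 a b s k = moment3 b s k.+1 - a *: moment3 b s k.
Proof. by apply/matrixP => i j; rewrite !mxE; ring. Qed.

Lemma moment2_moment4 a b s k :
  moment2 a b s k = b *: moment4 a s k - moment4 a s k.+1.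
Proof. by apply/matrixP => i j; rewrite !mxE; ring. Qed.

Lemma blockHankel_trmxC t n :
  (forall k, (k <= 2 * n)%N -> (t k) ^t* = t k) ->
  (blockHankel t n) ^t* = blockHankel t n.
Proof.
move=> tH; apply/matrixP => i j; rewrite !mxE addnC.
set k := (_ + _)%N; have kn : (k <= 2 * n)%N.
  by rewrite mul2n -addnn leq_add // -ltnS.
by rewrite -[in RHS](tH k kn) !mxE.
Qed.

Lemma ucol_bcol s n : ucol s n = bcol n (fun k => - s k).
Proof. by []. Qed.

(** [T] shifts the block rows of [Htilde1] down and so restores every row but the first; that one is
    minus the adjoint of [ucol], the moments being Hermitian. *)
Lemma blockHankel_displacement s n :
  (forall k, (k <= n)%N -> (s k) ^t* = s k) ->
  blockHankel s n =
    T C q n *m Htilde1 s n - vcol C q n *m (ucol s n) ^t*.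
Proof.
move=> sH; apply: mul_bcol_eq => m x.
rewrite mulmxBl -!mulmxA !blockHankel_bcol T_bcol ucol_bcol mul_bcol vcol_bcol.
rewrite bcol_mul bcolN bcolD; apply: eq_bcol => -[|k] _.
  rewrite add0r mul1mx -sumrN; apply: eq_bigr => l _.
  by rewrite trmxCN sH ?mulNmx ?opprK // -ltnS.
by rewrite mul0mx subr0; apply: eq_bigr => l _; rewrite addSn.
Qed.

(** The vanishing sums are the orthogonality relations of the matrix polynomial with leading
    coefficient [I]. *)
Lemma Sigma_bcol t j :
  (forall i, j = i.+1 -> blockHankel t i \in unitmx) ->
  exists x : nat -> 'M[C]_q,
    [/\ Sigma t j = bcol j x, x j = 1%:M
      & forall k, (k < j)%N -> \sum_(l < j.+1) t (k + l)%N *m x l = 0].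
Proof.
case: j => [_|j /(_ j erefl) Hunit]; first by exists (fun=> 1%:M).
have [x xE] := bcolP (- (invmx (blockHankel t j) *m Y t j.+1)).
exists (fun k => if k == j.+1 then 1%:M else x k); split.
- rewrite /Sigma xE; apply: eq_mxcol => k; case: unliftP => [i ->|->] /=.
    have ij : (i < j.+1)%N := ltn_ord i.
    by rewrite /bump leqNgt ij ltn_eqF // (mxcolK _ (i : 'I_j.+1)).
  by rewrite eqxx.
- by rewrite eqxx.
move=> k kj; rewrite big_ord_recr /= eqxx mulmx1.
have := congr1 (mulmx (blockHankel t j)) xE.
rewrite mulmxN mulKVmx // blockHankel_bcol.
have -> : Y t j.+1 = bcol j (fun k => t (j.+1 + k)%N) by [].
rewrite bcolN => /bcol_inj/(_ k kj) tE.
rewrite addnC -[t _]opprK tE; apply/eqP; rewrite subr_eq0; apply/eqP.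
by apply: eq_bigr => i _; rewrite ltn_eqF ?ltn_ord.
Qed.

(** On a kernel vector, [H3] acts as minus [Htilde1] and [H4] as plus [Htilde1], so two nonnegative
    forms are opposite. *)
Lemma blockHankel_unit a b s n :
  posdefmx (H3 b s n) -> posdefmx (H4 a s n) -> blockHankel s n \in unitmx.
Proof.
move=> H3pos H4pos; apply: unitmx_ker => x Hx.
apply: posdefmx_eq0 H3pos _; have := posdefmx_ge0 x H4pos.
rewrite -!mulmxA H3E H4E !mulmxBl -!scalemxAl Hx !scaler0 subr0 sub0r.
by rewrite mulmxN [X in _ -> X <= _]mxE oppr_le0.
Qed.

(** Read a kernel vector as a polynomial x(t). Then [H3] applied to (t - a)x and [H4] applied to (b
    - t)x give the same column, supported in the last block, where these two polynomials have
    opposite coefficients. The two forms are thus opposite, both polynomials vanish, and so does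
    their sum (b - a)x. *)
Lemma blockHankel_moment2_unit a b s n :
  a != b -> posdefmx (H3 b s n.+1) -> posdefmx (H4 a s n.+1) ->
  blockHankel (moment2 a b s) n \in unitmx.
Proof.
move=> neq_ab H3pos H4pos; apply: unitmx_ker => x'.
have [x0 ->] := bcolP x' => {x'}.
set x := fun k => if (k <= n)%N then x0 k else 0.
rewrite (_ : bcol n x0 = bcol n x); last first.
  by apply: eq_bcol => k kn; rewrite /x kn.
have x_out : x n.+1 = 0 by rewrite /x ltnn.
pose pred_x k : 'cV[C]_q := if k is k'.+1 then x k' else 0.
have shiftE t k : \sum_(l < n.+2) t (k + l)%N *m pred_x l
    = \sum_(l < n.+1) t (k.+1 + l)%N *m x l.
  rewrite big_ord_recl mulmx0 add0r; apply: eq_bigr => l _.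
  by rewrite /= /bump /= add1n addnS.
have truncE t k : \sum_(l < n.+2) t (k + l)%N *m x l
    = \sum_(l < n.+1) t (k + l)%N *m x l.
  by rewrite big_ord_recr /= x_out mulmx0 addr0.
rewrite blockHankel_bcol => Hx.
have Hx0 k : (k <= n)%N -> \sum_(l < n.+1) moment2 a b s (k + l)%N *m x l = 0.
  by move=> kn; move: Hx; rewrite -(bcol0 C q n 1) => /bcol_inj/(_ k kn).
pose eta k : 'cV[C]_q := pred_x k - a *: x k.
pose zeta k : 'cV[C]_q := b *: x k - pred_x k.
pose c k : 'cV[C]_q := \sum_(l < n.+1) moment2 a b s (k + l)%N *m x l.
have H3eta : H3 b s n.+1 *m bcol n.+1 eta = bcol n.+1 c.
  rewrite blockHankel_bcol; apply: eq_bcol => k _.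
  under eq_bigr do rewrite mulmxBr -scalemxAr.
  rewrite sumrB shiftE -scaler_sumr truncE scaler_sumr -sumrB.
  apply: eq_bigr => l _.
  by rewrite moment2_moment3 [RHS]mulmxBl -scalemxAl addSn.
have H4zeta : H4 a s n.+1 *m bcol n.+1 zeta = bcol n.+1 c.
  rewrite blockHankel_bcol; apply: eq_bcol => k _.
  under eq_bigr do rewrite mulmxBr -scalemxAr.
  rewrite sumrB shiftE -scaler_sumr truncE scaler_sumr -sumrB.
  apply: eq_bigr => l _.
  by rewrite moment2_moment4 [RHS]mulmxBl -scalemxAl addSn.
have dot_c (y : nat -> 'M[C]_(q, 1)) :
    (bcol n.+1 y) ^t* *m bcol n.+1 c = (y n.+1) ^t* *m c n.+1.
  rewrite mul_bcol big_ord_recr big1 => [|k _]; first exact: add0r.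
  by rewrite [c _](Hx0 _ (ltn_ord k)) mulmx0.
have eta0 : bcol n.+1 eta = 0.
  apply: posdefmx_eq0 H3pos _; have := posdefmx_ge0 (bcol n.+1 zeta) H4pos.
  rewrite -!mulmxA H3eta H4zeta !dot_c /eta /zeta x_out !scaler0 sub0r subr0.
  by rewrite trmxCN mulNmx [X in 0 <= X -> _]mxE oppr_ge0.
(* Pairing [c] with [eta], now zero, gives up to sign the form of [zeta]. *)
have zeta0 : bcol n.+1 zeta = 0.
  apply: posdefmx_eq0 H4pos _.
  rewrite -!mulmxA H4zeta !dot_c /zeta x_out scaler0 sub0r.
  have := dot_c eta; rewrite eta0 trmx0 map_mx0 mul0mx /eta x_out scaler0 subr0.
  by rewrite trmxCN mulNmx => <-; rewrite oppr0 mxE.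
have : bcol n.+1 (fun k => (b - a) *: x k) = bcol n.+1 (fun=> 0).
  rewrite bcol0 -[RHS]addr0 -{1}eta0 -zeta0 bcolD.
  apply: eq_bcol => k _; rewrite /eta /zeta.
  by apply/matrixP => i j; rewrite !mxE; ring.
move=> /bcol_inj x0E; rewrite -(bcol0 C q n 1); apply: eq_bcol => k kn.
have /eqP := x0E k (leqW kn); rewrite scaler_eq0 subr_eq0 eq_sym.
by rewrite (negPf neq_ab) /= => /eqP.
Qed.

End Moments.

(** * Resolvents of the shift and the matrix polynomials *)

Section Resolvents.
Variables (C : numClosedFieldType) (q : nat).
Implicit Types (a b z : C) (s t : nat -> 'M[C]_q).

Lemma sub_T_bcol n z m (x : nat -> 'M[C]_(q, m)) :
  (1%:M - z *: T C q n) *m bcol n x =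
    bcol n (fun k => if k is k'.+1 then x k - z *: x k' else x 0%N).
Proof.
rewrite mulmxBl mul1mx -scalemxAl T_bcol bcolZ bcolN bcolD.
by apply: eq_bcol => -[|k] _ //; rewrite scaler0 subr0.
Qed.

Lemma sub_T_unit n z : 1%:M - z *: T C q n \in unitmx.
Proof.
apply: unitmx_ker => X; have [x ->] := bcolP X.
rewrite sub_T_bcol -(bcol0 C q n 1) => /bcol_inj x0; apply: eq_bcol.
elim=> [|k IHk] kn; first exact: (x0 0%N).
by have := x0 _ kn; rewrite (IHk (ltnW kn)) scaler0 subr0.
Qed.

Lemma Res_mul n z m (X Y : 'M[C]_(\sum_(k < n.+1) q, m)) :
  (1%:M - z *: T C q n) *m X = Y -> Res q n z *m Y = X.
Proof. by move=> <-; rewrite mulKmx ?sub_T_unit. Qed.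

Lemma Res_bcol n z (x y : nat -> 'M[C]_q) :
  (forall k, (k <= n)%N ->
     (if k is k'.+1 then y k - z *: y k' else y 0%N) = x k) ->
  Res q n z *m bcol n x = bcol n y.
Proof. by move=> yx; apply: Res_mul; rewrite sub_T_bcol; apply: eq_bcol. Qed.

Lemma Res_bcol_inv n z (x y : nat -> 'M[C]_q) :
  Res q n z *m bcol n x = bcol n y ->
  forall k, (k <= n)%N ->
    (if k is k'.+1 then y k - z *: y k' else y 0%N) = x k.
Proof.
move=> xy k kn; have := congr1 (mulmx (1%:M - z *: T C q n)) xy.
by rewrite mulKVmx ?sub_T_unit // sub_T_bcol => /bcol_inj/(_ k kn).
Qed.

(** Splitting off the first block of [Sigma] lowers the resolvent from n+1 to n. The map [w] is
    injective because its last block is [I]. *)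
Lemma P1_Q1_shift s n :
  blockHankel s n \in unitmx ->
  exists (c : 'M[C]_q) (w : 'M[C]_(\sum_(k < n.+1) q, q)),
    [/\ Htilde1 s n *m w = ucol s n *m c,
        forall m (y : 'M[C]_(q, m)), w *m y = 0 -> y = 0,
        forall z, P1 s n.+1 z = c ^t* + z *: (w ^t* *m Res q n z *m vcol C q n)
      & forall z, Q1 s n.+1 z = - (w ^t* *m Res q n z *m ucol s n)].
Proof.
move=> Hunit; have [i [<-] //|x [SE x1 Hx]] := @Sigma_bcol _ _ s n.+1.
exists (x 0%N), (bcol n (fun k => x k.+1)); split.
- rewrite blockHankel_bcol ucol_bcol bcol_mul; apply: eq_bcol => k kn.
  have /eqP := Hx k kn; rewrite big_ord_recl addn0 addrC addr_eq0 mulNmx.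
  by move=> /eqP <-; apply: eq_bigr => l _; rewrite /= /bump /= add1n addnS.
- move=> m y; rewrite bcol_mul -bcol0 => /bcol_inj/(_ n (leqnn n)).
  by rewrite x1 mul1mx.
- move=> z; rewrite /P1 /P SE -!mulmxA.
  have [p pE] := bcolP (Res q n z *m vcol C q n).
  have := pE; rewrite !vcol_bcol => /Res_bcol_inv pI.
  (* R_(n+1)(z) v_(n+1) is [I] followed by z R_n(z) v_n. *)
  rewrite (@Res_bcol _ _ _ (fun k => if k is k'.+1 then z *: p k' else 1%:M)).
    rewrite -vcol_bcol pE !mul_bcol big_ord_recl /= mulmx1 scaler_sumr.
    by congr (_ + _); apply: eq_bigr => k _; rewrite -scalemxAr.
  case=> [|[|k]] // kn; first by rewrite -(pI 0%N) // subrr.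
  have := pI k.+1 kn => /=.
  by rewrite -scalerBr => ->; rewrite scaler0.
move=> z; rewrite /Q1 SE -!mulmxA; congr (- _).
have [p pE] := bcolP (Res q n z *m ucol s n).
have := pE; rewrite ucol_bcol => /Res_bcol_inv pI.
rewrite /u1 ucol_bcol T_bcol.
(* Here the column is already shifted: a zero block followed by R_n(z) u_n. *)
rewrite (@Res_bcol _ _ _ (fun k => if k is k'.+1 then p k' else 0)).
  rewrite -ucol_bcol pE !mul_bcol big_ord_recl /= mulmx0 add0r.
  by [].
case=> [|[|k]] // kn; first by rewrite -(pI 0%N) // scaler0 subr0.
by rewrite -(pI k.+1).
Qed.

Lemma Sigma0 t : Sigma t 0 = bcol 0 (fun=> 1%:M).
Proof. by []. Qed.

(** With [Q2E], this spares a separate treatment of n = 0. *)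
Lemma PE t n z : P t n z = (Sigma t n) ^t* *m Res q n z *m vcol C q n.
Proof.
case: n => [|n] //; rewrite [LHS]/= Sigma0 -mulmxA vcol_bcol.
rewrite (@Res_bcol _ _ _ (fun=> 1%:M)); last by case.
by rewrite mul_bcol big_ord1 trmxC1 mul1mx.
Qed.

Lemma Q2E a b s n z :
  Q2 a b s n z =
    - ((Sigma (moment2 a b s) n) ^t* *m Res q n z *m u2 a b s n z).
Proof.
case: n => [|n] //; rewrite [LHS]/= Sigma0 -mulmxA.
rewrite /u2 uhat2_bcol vcol_bcol bcol_mul bcolZ bcolD.
rewrite (@Res_bcol _ _ _ (fun=> s 1%N - (a + b) *: s 0%N + z *: s 0%N)).
  rewrite mul_bcol big_ord1 trmxC1 mul1mx.
  by apply/matrixP => i j; rewrite !mxE; ring.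
by case=> // _; rewrite mul1mx.
Qed.

Lemma blockHankel_vcol t n : blockHankel t n *m vcol C q n = bcol n t.
Proof.
rewrite vcol_bcol blockHankel_bcol; apply: eq_bcol => k _.
rewrite big_ord_recl big1 => [|l _]; last by rewrite mulmx0.
by rewrite mulmx1 addn0 addr0.
Qed.

(** Adapted to the resolvent, which cancels against the first summand; the second vanishes at z =
    a. *)
Lemma u2E a b s n z :
  u2 a b s n z =
    - ((1%:M - z *: T C q n) *m (H3 b s n *m vcol C q n)
       + (z - a) *: ((1%:M - b *: T C q n) *m ucol s n)).
Proof.
rewrite blockHankel_vcol ucol_bcol !sub_T_bcol /u2 uhat2_bcol vcol_bcol.
rewrite bcol_mul !bcolZ !bcolD bcolN; apply: eq_bcol => -[|k] _.
  by rewrite mul1mx; apply/matrixP => i j; rewrite !mxE; ring.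
rewrite mul0mx moment2_moment3.
by apply/matrixP => i j; rewrite !mxE; ring.
Qed.

(** Below the first block, the rows on the left are the orthogonality relations for [moment2]. *)
Lemma Sigma2_H3 a b s n :
  (forall i, n = i.+1 -> blockHankel (moment2 a b s) i \in unitmx) ->
  let S := Sigma (moment2 a b s) n in
  (1%:M - a *: T C q n) *m (H3 b s n *m S) =
    vcol C q n *m ((vcol C q n) ^t* *m (H3 b s n *m S)).
Proof.
move=> /Sigma_bcol [x [-> _ Hx]] /=.
rewrite blockHankel_bcol vcol_tr_mul_bcol sub_T_bcol vcol_bcol bcol_mul.
apply: eq_bcol => -[|k] kn; first by rewrite mul1mx.
rewrite mul0mx scaler_sumr -sumrB -[RHS](Hx k kn).
by apply: eq_bigr => l _; rewrite moment2_moment3 [RHS]mulmxBl -scalemxAl.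
Qed.

Lemma Sigma_mul_eq0 t n m (y : 'M[C]_(q, m)) :
  (forall i, n = i.+1 -> blockHankel t i \in unitmx) ->
  Sigma t n *m y = 0 -> y = 0.
Proof.
move=> /Sigma_bcol [x [-> x1 _]]; rewrite bcol_mul -bcol0.
by move=> /bcol_inj/(_ n (leqnn n)); rewrite x1 mul1mx.
Qed.

End Resolvents.

(** * Tactics for matrix identities *)

(* Rewriting leaves the same operation at convertible but syntactically
   different ring structures, which would hide equal products from ring. *)
Ltac mxcanon :=
  try match goal with |- context [@mulmx ?R0] =>
    repeat match goal with |- context [@mulmx ?R1] =>
      tryif constr_eq R1 R0 then fail
      else change (@mulmx R1) with (@mulmx R0)
    end
  end;
  try match goal with |- context [@scalar_mx ?R0 ?n ?c0] =>
    let I := constr:(@scalar_mx R0 n c0) in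
    repeat match goal with |- context [@scalar_mx ?R1 n ?c1] =>
      tryif constr_eq_strict (@scalar_mx R1 n c1) I then fail
      else change (@scalar_mx R1 n c1) with I
    end
  end.

(** Products and inverses become atoms, since passing to entries would otherwise expand each product
    into a sum. *)
Ltac mxatoms := repeat match goal with
  | |- context [@mulmx ?R ?m ?n ?p ?A ?B] => generalize (@mulmx R m n p A B)
  | |- context [@invmx ?R ?n ?A] => generalize (@invmx R n A)
  | |- context [@scalar_mx ?R ?n ?c] => generalize (@scalar_mx R n c)
  end.

(* Decides identities that are linear over the scalars once products of
   matrices are expanded. *)
Ltac mxlin :=
  rewrite ?(mulmxDl, mulmxDr, mulNmx, mulmxN, =^~ scalemxAl, =^~ scalemxAr,
            mulmx1, mul1mx, =^~ mulmxA);
  mxcanon; mxatoms; intros; apply/matrixP => ? ?; rewrite !mxE; ring.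

(** * Block algebra derived from the displacement identities *)

(* [H1], [Ht] stand for H_(1,n) and the shifted Hankel matrix; [Ts], [ur], [vr]
   stand for the adjoints of [T], [u], [v], and [M], [Nm], [d] for M^(2n+1),
   N^(2n+1) and (d^(2n+1))^*. *)
Section Displacement.
Variables (F : fieldType) (N q : nat) (H1 Ht T Ts : 'M[F]_N).
Variables (u v : 'M[F]_(N, q)) (ur vr : 'M[F]_(q, N)) (a b z : F).

Let H3 := b *: H1 - Ht.
Let H4 := Ht - a *: H1.
Local Notation R x := (invmx (1%:M - x *: Ts)).
Let K := R z.
Let G := invmx H3 *m Ht *m invmx H4.
Let M := - a *: (ur *m invmx Ht *m u).
Let Nm := - b *: (vr *m invmx H4 *m Ht *m invmx H3 *m v).
Let d := 1%:M - a *: (ur *m invmx H4 *m v).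

Hypotheses (HtU : Ht \in unitmx) (H3U : H3 \in unitmx) (H4U : H4 \in unitmx).
Hypothesis RU : forall x, 1%:M - x *: Ts \in unitmx.
Hypotheses (dispL : H1 = T *m Ht - v *m ur) (dispR : H1 = Ht *m Ts - u *m vr).

Lemma resolvent_mulr x : x *: (R x *m Ts) = R x - 1%:M.
Proof.
have E : R x *m (1%:M - x *: Ts) = 1%:M by rewrite mulVmx ?RU.
by rewrite -[X in _ = _ - X]E; mxlin.
Qed.

Lemma resolvent_mull x : x *: (Ts *m R x) = R x - 1%:M.
Proof.
have E : (1%:M - x *: Ts) *m R x = 1%:M by rewrite mulmxV ?RU.
by rewrite -[X in _ = _ - X]E; mxlin.
Qed.

Lemma resolvent_comm x : Ts *m R x = R x *m Ts.
Proof.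
have E : (1%:M - x *: Ts) *m Ts = Ts *m (1%:M - x *: Ts) by mxlin.
by rewrite -[LHS](mulKmx (RU x)) (mulmxA _ Ts) E -!mulmxA mulmxV ?RU ?mulmx1.
Qed.

Lemma H4_mulVt : H4 *m invmx Ht = 1%:M - a *: T + a *: (v *m ur *m invmx Ht).
Proof.
rewrite /H4 dispL mulmxBl mulmxV // -scalemxAl mulmxBl mulmxK //.
by mxlin.
Qed.

(** [M] is made for this: [H4_mulVt] turns H_4 Ht^-1 u into u_4 - v M. The factor with [M] thus
    trades H_4^-1 for Ht^-1 in the first block column. *)
Lemma H4_gauge : invmx H4 *m ((1%:M - a *: T) *m u - v *m M) = invmx Ht *m u.
Proof.
rewrite -[RHS](mulKmx H4U); congr (_ *m _).
by rewrite [RHS]mulmxA H4_mulVt /M; mxlin.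
Qed.

Lemma H4VtH3_comm : H4 *m invmx Ht *m H3 = H3 *m invmx Ht *m H4.
Proof.
rewrite /H3 /H4; rewrite !(mulmxBl, mulmxBr) !mulmxV //.
rewrite -!mulmxA -!scalemxAl -!scalemxAr !mulVmx // !mulmx1 !mul1mx.
by mxlin.
Qed.

Lemma mulG_l : H4 *m invmx Ht *m H3 *m G = 1%:M.
Proof. by rewrite /G -!mulmxA mulKVmx // mulKmx // mulmxV. Qed.

(** [Nm] has [H4] and [H3] in the other order; by [H4VtH3_comm] both orders invert the same
    product. *)
Lemma GE : invmx H4 *m Ht *m invmx H3 = G.
Proof.
rewrite -[LHS]mulmx1 -mulG_l H4VtH3_comm -!mulmxA mulKmx // mulKVmx //.
by rewrite mulKmx.
Qed.

Lemma NmE : Nm = - b *: (vr *m G *m v).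
Proof. by rewrite /Nm -GE !mulmxA. Qed.

Lemma Ht_mulG : b *: (invmx Ht *m H1 *m G) = invmx H4 + G.
Proof.
have -> : invmx H4 = invmx Ht *m H3 *m G by rewrite /G -!mulmxA mulKVmx ?mulKmx.
rewrite -[X in _ = _ + X]mul1mx -(mulVmx HtU) -mulmxDl -mulmxDr /H3 subrK.
by rewrite -scalemxAr -scalemxAl.
Qed.

(** Multiplying the first block column by [Nm] creates the product of [u] and [vr]; its replacement
    is absorbed by the resolvent and by [Ht_mulG]. *)
Lemma Ht_u_vr : invmx Ht *m u *m vr = Ts - invmx Ht *m H1.
Proof. by rewrite [H1 in RHS]dispR mulmxBr mulKmx // subKr mulmxA. Qed.

(** From z (I - a Ts) - a (I - z Ts) = (z - a) I; the source of the factor z - a in the lower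
    blocks. *)
Lemma resolvent_sub :
  z *: ((1%:M - a *: Ts) *m K) - a *: 1%:M = (z - a) *: K.
Proof.
transitivity (z *: K - a *: (z *: (Ts *m K)) - a *: 1%:M); first by mxlin.
by rewrite resolvent_mull -/K; mxlin.
Qed.

Lemma V4_ul :
  1%:M + z *: (vr *m (K *m invmx H4) *m ((1%:M - a *: T) *m u))
    - z *: (vr *m (K *m invmx H4) *m v) *m M
  = 1%:M + z *: (vr *m K *m invmx Ht *m u).
Proof.
transitivity (1%:M + z *: (vr *m K *m
                 (invmx H4 *m ((1%:M - a *: T) *m u - v *m M)))).
  by mxlin.
by rewrite H4_gauge; mxlin.
Qed.

Lemma V4_dl :
  z *: (ur *m (1%:M - a *: Ts) *m (K *m invmx H4) *m ((1%:M - a *: T) *m u))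
    + (1%:M - z *: (ur *m (1%:M - a *: Ts) *m (K *m invmx H4) *m v)) *m M
  = (z - a) *: (ur *m K *m invmx Ht *m u).
Proof.
transitivity (z *: (ur *m (1%:M - a *: Ts) *m K *m
                 (invmx H4 *m ((1%:M - a *: T) *m u - v *m M))) + M).
  by mxlin.
rewrite H4_gauge /M.
transitivity (ur *m (z *: ((1%:M - a *: Ts) *m K) - a *: 1%:M)
                *m invmx Ht *m u); first by mxlin.
by rewrite resolvent_sub; mxlin.
Qed.

Lemma V4_ur :
  (1%:M + z *: (vr *m K *m invmx Ht *m u)) *m Nm
    - z *: (vr *m (K *m invmx H4) *m v)
  = - (b - z) *: (vr *m K *m G *m v).
Proof.
transitivity (vr *m (- b *: ((1%:M + z *: (K *m (invmx Ht *m u *m vr))) *m G)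
                     - z *: (K *m invmx H4)) *m v).
  by rewrite NmE; mxlin.
rewrite Ht_u_vr.
transitivity (vr *m (- b *: ((1%:M + z *: (K *m Ts)) *m G)
    + z *: (K *m (b *: (invmx Ht *m H1 *m G) - invmx H4))) *m v).
  by mxlin.
by rewrite Ht_mulG resolvent_mulr -/K; mxlin.
Qed.

Lemma V4_dr :
  ((z - a) *: (ur *m K *m invmx Ht *m u)) *m Nm
    + (1%:M - z *: (ur *m (1%:M - a *: Ts) *m (K *m invmx H4) *m v))
  = d + (z - a) *: (ur *m (1%:M - b *: Ts) *m K *m G *m v).
Proof.
transitivity (1%:M - ur *m (
    (z - a) *: (b *: (K *m (invmx Ht *m u *m vr) *m G))
    + z *: ((1%:M - a *: Ts) *m K) *m invmx H4) *m v).
  by rewrite NmE; mxlin.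
rewrite Ht_u_vr.
transitivity (1%:M - ur *m (
    (z - a) *: (b *: (K *m Ts *m G) - K *m (b *: (invmx Ht *m H1 *m G)))
    + (z *: ((1%:M - a *: Ts) *m K) - a *: 1%:M + a *: 1%:M) *m invmx H4) *m v).
  by mxlin.
by rewrite Ht_mulG resolvent_sub -resolvent_comm -/K /d; mxlin.
Qed.

(** * First block column: quotients by P_1 at a *)

Section FirstKind.
(* [c] and [Pa] are the values of P_(1,n+1)^* at 0 and a. *)
Variables (c : 'M[F]_q) (w : 'M[F]_(N, q)).
Hypotheses (Ht_w : Ht *m w = u *m c).
Hypothesis w_inj : forall y : 'cV[F]_q, w *m y = 0 -> y = 0.
Let Pa := c + a *: (vr *m R a *m w).

Lemma first_coef_unit : c \in unitmx.
Proof.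
apply: unitmx_ker => y cy; apply: w_inj.
by rewrite -(mulKmx HtU w) Ht_w -!mulmxA cy !mulmx0.
Qed.

Lemma Vt_u_first : invmx Ht *m u = w *m invmx c.
Proof. by rewrite -[u](mulmxK first_coef_unit) -Ht_w -mulmxA mulKmx. Qed.

(** Apply H_4 = Ht (I - a Ts) + a u vr to R(a) w. *)
Lemma H4_R_w : R a *m w = invmx H4 *m u *m Pa.
Proof.
rewrite -mulmxA -[LHS](mulKmx H4U); congr (_ *m _).
have -> : H4 = Ht *m (1%:M - a *: Ts) + a *: (u *m vr).
  by rewrite /H4 dispR; mxlin.
rewrite mulmxDl -mulmxA mulKVmx ?RU // Ht_w /Pa.
by mxlin.
Qed.

Lemma Pa_unit : Pa \in unitmx.
Proof.
apply: unitmx_ker => y py; apply: w_inj.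
have := H4_R_w => /(congr1 (fun X => X *m y)).
rewrite -!mulmxA py !mulmx0 => /(congr1 (mulmx (1%:M - a *: Ts))).
by rewrite mulKVmx ?RU // mulmx0.
Qed.

(** By [H4_R_w], [Pa] exceeds [c] by a vr H_4^-1 u [Pa]. The quotient is d^(2n+1). *)
Lemma first_quotient : c *m invmx Pa = 1%:M - a *: (vr *m invmx H4 *m u).
Proof.
rewrite -[RHS](mulmxK Pa_unit); congr (_ *m _).
rewrite mulmxBl mul1mx -scalemxAl -!mulmxA (mulmxA (invmx H4)) -H4_R_w /Pa.
by rewrite mulmxA addrK.
Qed.

Lemma V4_ul_quotient :
  (1%:M + z *: (vr *m K *m invmx Ht *m u)) *m (c *m invmx Pa)
  = (c + z *: (vr *m K *m w)) *m invmx Pa.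
Proof.
rewrite -!mulmxA Vt_u_first mulmxA; congr (_ *m _).
rewrite mulmxDl mul1mx -scalemxAl -!mulmxA mulVmx ?first_coef_unit //.
by rewrite mulmx1 mulmxA.
Qed.

Lemma V4_dl_quotient :
  ur *m K *m invmx Ht *m u *m (c *m invmx Pa)
  = ur *m K *m w *m invmx Pa.
Proof.
rewrite -!mulmxA (mulmxA (invmx Ht)) Vt_u_first -!mulmxA.
by rewrite mulKmx ?first_coef_unit.
Qed.

End FirstKind.

(** * Second block column: quotients by Q_2 at a *)

Section SecondKind.
Variable S : 'M[F]_(N, q).
Hypothesis S_H3 : (1%:M - a *: T) *m (H3 *m S) = v *m (vr *m (H3 *m S)).
Hypothesis S_inj : forall y : 'cV[F]_q, S *m y = 0 -> y = 0.
Hypothesis dU : d \in unitmx.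
Let E := vr *m H3 *m S + a *: (ur *m invmx Ht *m H3 *m S).
Let Qa := vr *m H3 *m S.

(** [S_H3] and the correction term of [H4_mulVt] each factor through [v]; [E] adds up the two
    coefficients. *)
Lemma H4VtH3_S : H4 *m invmx Ht *m H3 *m S = v *m E.
Proof.
rewrite H4_mulVt.
transitivity ((1%:M - a *: T) *m (H3 *m S)
              + a *: (v *m (ur *m invmx Ht *m H3 *m S))); first by mxlin.
by rewrite S_H3 /E; mxlin.
Qed.

Lemma G_v_E : G *m v *m E = S.
Proof.
by rewrite -mulmxA -H4VtH3_S /G -!mulmxA mulKmx // mulKVmx // mulKmx.
Qed.

(** The second term of [E] equals a ur H_4^-1 v [E], which [d] removes. *)
Lemma d_E : d *m E = Qa.
Proof.
rewrite /Qa /d mulmxBl mul1mx -scalemxAl -!mulmxA -H4VtH3_S.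
by rewrite -!mulmxA mulKmx // /E !mulmxA addrK.
Qed.

Lemma E_unit : E \in unitmx.
Proof.
apply: unitmx_ker => y Ey; apply: S_inj.
by rewrite -G_v_E -!mulmxA Ey !mulmx0.
Qed.

Lemma Qa_unit : Qa \in unitmx.
Proof. by rewrite -d_E unitmx_mul dU E_unit. Qed.

Lemma invd_E : invmx d = E *m invmx Qa.
Proof. by rewrite -[RHS](mulKmx dU) (mulmxA d) d_E mulmxV ?mulmx1 ?Qa_unit. Qed.

Lemma V4_ur_quotient :
  (- (b - z) *: (vr *m K *m G *m v)) *m invmx d
  = - (b - z) *: (vr *m K *m S *m invmx Qa).
Proof. by rewrite -scalemxAl invd_E -[in RHS]G_v_E !mulmxA. Qed.

(** Inserting (I - z Ts) K = I into [Qa] lets both terms share the factor K S and match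
    [Q2_trmxC]. *)
Lemma V4_dr_quotient :
  (d + (z - a) *: (ur *m (1%:M - b *: Ts) *m K *m G *m v)) *m invmx d
  = (vr *m H3 *m (1%:M - z *: Ts) + (z - a) *: (ur *m (1%:M - b *: Ts)))
      *m K *m S *m invmx Qa.
Proof.
rewrite invd_E mulmxA; congr (_ *m _).
have GvE : ur *m (1%:M - b *: Ts) *m K *m G *m v *m E
    = ur *m (1%:M - b *: Ts) *m K *m S by rewrite -[in RHS]G_v_E !mulmxA.
rewrite mulmxDl d_E /Qa -scalemxAl GvE -/K.
rewrite !mulmxDl -!mulmxA (mulmxA (1%:M - z *: Ts)) mulmxV ?RU // mul1mx.
by rewrite -scalemxAl !mulmxA.
Qed.

End SecondKind.

End Displacement.

(** * Comparison of the two resolvent matrices *)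

(** Conjugation by [Jmx] exchanges the blocks along both diagonals; the scalar factors affect only
    the off-diagonal blocks. *)
Lemma swap_block_mx (C : numClosedFieldType) q (x : C)
    (X11 X12 X21 X22 D1 D2 : 'M[C]_q) :
  x != 0 ->
  Jmx *m (block_mx 1%:M 0 0 (x^-1)%:M *m block_mx X11 X12 X21 X22
            *m block_mx 1%:M 0 0 x%:M) *m Jmx *m block_mx D1 0 0 D2
  = block_mx (X22 *m D1) (x^-1 *: X21 *m D2) (x *: X12 *m D1) (X11 *m D2).
Proof.
move=> x0; rewrite /Jmx !mulmx_block.
rewrite !(mulmx1, mul1mx, mulmx0, mul0mx, addr0, add0r).
by rewrite !mul_scalar_mx !mul_mx_scalar scalerA mulfV // scale1r.
Qed.

Section Resolvent.
Variables (C : numClosedFieldType) (q n : nat) (a b : C) (s : nat -> 'M[C]_q).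
Hypotheses (a_real : a^* = a) (b_real : b^* = b) (neq_ab : a != b).
Hypothesis s_herm : forall k, (k <= 2 * n + 1)%N -> (s k) ^t* = s k.
Hypotheses (H3pos : posdefmx (H3 b s n)) (H4pos : posdefmx (H4 a s n)).
Hypothesis HtU : Htilde1 s n \in unitmx.

Lemma blockHankel_displacement_trmxC :
  blockHankel s n = Htilde1 s n *m (T C q n) ^t* - ucol s n *m (vcol C q n) ^t*.
Proof.
have s_herm0 k : (k <= 2 * n)%N -> (s k) ^t* = s k.
  by move=> kn; apply: s_herm; rewrite addn1 leqW.
rewrite -[LHS]blockHankel_trmxC // blockHankel_displacement; last first.
  by move=> k kn; apply: s_herm0; rewrite mul2n -addnn (leq_trans kn) ?leq_addr.
rewrite !trmxCE trmxCK [(Htilde1 s n) ^t*]blockHankel_trmxC // => k kn.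
by apply: s_herm; rewrite addn1.
Qed.

Lemma sub_T_trmxC_unit x : 1%:M - x *: (T C q n) ^t* \in unitmx.
Proof. by rewrite -unitmx_trmxC !trmxCE trmxCK sub_T_unit. Qed.

Lemma Res_trmxC x : (Res q n x^*) ^t* = invmx (1%:M - x *: (T C q n) ^t*).
Proof. by rewrite /Res !trmxCE conjCK. Qed.

Lemma moment2_unit i :
  n = i.+1 -> blockHankel (moment2 a b s) i \in unitmx.
Proof.
by move=> ni; apply: blockHankel_moment2_unit => //; rewrite -ni.
Qed.

Lemma Q2_trmxC x :
  (Q2 a b s n x^*) ^t* =
    ((vcol C q n) ^t* *m H3 b s n *m (1%:M - x *: (T C q n) ^t*)
       + (x - a) *: ((ucol s n) ^t* *m (1%:M - b *: (T C q n) ^t*)))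
    *m invmx (1%:M - x *: (T C q n) ^t*) *m Sigma (moment2 a b s) n.
Proof.
have [/hermsymmx_trmxC H3_herm _] := H3pos.
have subT_conj y : (1%:M - y *: T C q n) ^t* = 1%:M - y^* *: (T C q n) ^t*.
  by rewrite trmxCD trmxC1 trmxCN trmxCZ.
rewrite Q2E u2E mulmxN opprK trmxCM trmxCM trmxCK Res_trmxC -mulmxA.
rewrite trmxCD trmxCZ !trmxCM !subT_conj H3_herm b_real conjCK.
by rewrite rmorphB /= conjCK a_real !mulmxA.
Qed.

Lemma Q2_trmxC_a :
  (Q2 a b s n a) ^t* =
    (vcol C q n) ^t* *m H3 b s n *m Sigma (moment2 a b s) n.
Proof.
have := Q2_trmxC a; rewrite a_real subrr scale0r addr0 => ->.
by rewrite -(mulmxA (_ *m H3 b s n)) mulmxV ?mulmx1 ?sub_T_trmxC_unit.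
Qed.

Lemma P2_trmxC x :
  (P2 a b s n x^*) ^t* =
    (vcol C q n) ^t* *m invmx (1%:M - x *: (T C q n) ^t*)
      *m Sigma (moment2 a b s) n.
Proof. by rewrite /P2 PE trmxCM trmxCM trmxCK Res_trmxC mulmxA. Qed.

Lemma U_eq_V z : z != a ->
  U a b s n z = Jmx *m V a b s n z *m Jmx *m Dmx a s n.
Proof.
move=> neq_za; set v := vcol C q n; set u := ucol s n.
have za0 : z - a != 0 by rewrite subr_eq0.
have [c [w [Ht_w w_inj P1E Q1E]]] := P1_Q1_shift (blockHankel_unit H3pos H4pos).
have {}w_inj : forall y : 'cV[C]_q, w *m y = 0 -> y = 0.
  by move=> y; apply: w_inj.
have P1_conj x : (P1 s n.+1 x^*) ^t* =
    c + x *: (v ^t* *m invmx (1%:M - x *: (T C q n) ^t*) *m w).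
  by rewrite P1E trmxCD trmxCZ trmxCM trmxCM !trmxCK conjCK Res_trmxC mulmxA.
have Q1_conj : (Q1 s n.+1 z^*) ^t* =
    - (u ^t* *m invmx (1%:M - z *: (T C q n) ^t*) *m w).
  by rewrite Q1E trmxCN trmxCM trmxCM !trmxCK Res_trmxC mulmxA.
have P1_0 : (P1 s n.+1 0) ^t* = c.
  by rewrite -(conjC0 C) P1_conj scale0r addr0.
have P1_a := P1_conj a; rewrite a_real in P1_a.
have [/hermsymmx_trmxC H4_herm _] := H4pos.
have H3U := posdefmx_unit H3pos; rewrite H3E in H3U.
have H4U := posdefmx_unit H4pos; rewrite H4E in H4U.
have dispL : blockHankel s n = T C q n *m Htilde1 s n - v *m u ^t*.
  apply: blockHankel_displacement => k kn; apply: s_herm.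
  by rewrite (leq_trans kn) // mul2n -addnn -addnA leq_addr.
have dispR := blockHankel_displacement_trmxC; have RU := sub_T_trmxC_unit.
have S_H3 := Sigma2_H3 moment2_unit; rewrite /= -/v H3E in S_H3.
have S_inj := fun y : 'cV[C]_q => @Sigma_mul_eq0 _ _ _ _ _ y moment2_unit.
have dE : dmx a s n = 1%:M - a *: (v ^t* *m invmx (H4 a s n) *m u).
  rewrite /dmx P1_0 P1_a H4E.
  exact: (first_quotient H4U RU dispR Ht_w w_inj).
have dcE : (dmx a s n) ^t* = 1%:M - a *: (u ^t* *m invmx (H4 a s n) *m v).
  rewrite dE trmxCD trmxC1 trmxCN trmxCZ trmxCM trmxCM trmxCK trmxCV.
  by rewrite H4_herm a_real mulmxA.
(* Both factors of [dmx] are invertible; this also yields invertibility of Q_2 at a, through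
   [Qa_unit]. *)
have dU : 1%:M - a *: (u ^t* *m invmx (H4 a s n) *m v) \in unitmx.
  rewrite -dcE unitmx_trmxC /dmx P1_0 P1_a unitmx_mul unitmx_inv.
  rewrite (first_coef_unit HtU Ht_w w_inj).
  exact: (Pa_unit H4U RU dispR Ht_w w_inj).
have u4_conj : (u4 a s n) ^t* = u ^t* *m (1%:M - a *: (T C q n) ^t*).
  by rewrite /u4 trmxCM trmxCD trmxC1 trmxCN trmxCZ a_real.
have V4E : V4 a b s n z = block_mx
    (1%:M + z *: (v ^t* *m invmx (1%:M - z *: (T C q n) ^t*)
                    *m invmx (Htilde1 s n) *m u))
    (- (b - z) *: (v ^t* *m invmx (1%:M - z *: (T C q n) ^t*)
       *m (invmx (H3 b s n) *m Htilde1 s n *m invmx (H4 a s n)) *m v))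
    ((z - a) *: (u ^t* *m invmx (1%:M - z *: (T C q n) ^t*)
                   *m invmx (Htilde1 s n) *m u))
    (1%:M - a *: (u ^t* *m invmx (H4 a s n) *m v)
       + (z - a) *: (u ^t* *m (1%:M - b *: (T C q n) ^t*)
            *m invmx (1%:M - z *: (T C q n) ^t*)
            *m (invmx (H3 b s n) *m Htilde1 s n *m invmx (H4 a s n)) *m v)).
  rewrite /V4 /Vtilde4 Res_trmxC u4_conj !mulmx_block.
  rewrite !(mulmx1, mulmx0, addr0, add0r) mulNmx H3E H4E /Mmx /Nmx H3E H4E.
  rewrite (V4_ul _ _ _ z HtU H4U dispL) (V4_dl _ z HtU H4U RU dispL).
  rewrite (V4_ur _ z HtU H3U H4U RU dispR).
  by rewrite (V4_dr _ _ z HtU H3U H4U RU dispR).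
rewrite /V V4E /Dmx swap_block_mx // dcE.
rewrite /U P1_conj Q1_conj Q2_trmxC P2_trmxC P1_a Q2_trmxC_a H3E H4E.
rewrite H4E in dU.
have -> : dmx a s n =
    c *m invmx (c + a *: (v ^t* *m invmx (1%:M - a *: (T C q n) ^t*) *m w)).
  by rewrite /dmx P1_0 P1_a.
(* After the swap, the blocks of [V4] appear in the order lower right, lower left, upper right,
   upper left. *)
congr block_mx.
- exact: esym (V4_dr_quotient z HtU H3U H4U RU dispL S_H3 S_inj dU).
- rewrite scalerA mulVf // scale1r mulNmx opprK; symmetry.
  exact: (V4_dl_quotient _ _ _ _ _ HtU Ht_w w_inj).
- rewrite -scalemxAl mulrC -mulrN -scalerA; congr (_ *: _).
  exact: esym (V4_ur_quotient _ z HtU H3U H4U dispL S_H3 S_inj dU).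
- exact: esym (V4_ul_quotient _ _ _ _ HtU Ht_w w_inj).
Qed.

End Resolvent.

Local Open Scope complex_scope.

Theorem theorem4p10 (R : realType) (a b : R) (q n : nat)
    (s : nat -> 'M[R[i]]_q)
    (hab : a < b) (hq : (1 <= q)%N)
    (hs : forall k, (k <= 2 * n + 1)%N -> s k \is hermsymmx)
    (hH3 : posdefmx (H3 b%:C s n))
    (hH4 : posdefmx (H4 a%:C s n))
    (hHt : Htilde1 s n \in unitmx)
    (hHt' : (1 <= n)%N -> Htilde1 s n.-1 \in unitmx)
    (z : R[i]) (hz : z != a%:C) :
  U a%:C b%:C s n z = Jmx *m V a%:C b%:C s n z *m Jmx *m Dmx a%:C s n.
Proof.
apply: U_eq_V => //; try exact: conjc_real.
- by rewrite (inj_eq (@complexI R)) lt_eqF.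
- by move=> k kn; apply/hermsymmx_trmxC/hs.
Qed.
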